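(* Let $X$ and $Y$ be Banach spaces and suppose that $Y$ has property $\mathcal Q_p$ for some $p\in(1,\infty]$. (1) Suppose $p\in(1,\infty)$. If there is a coarse map $f\colon X\to Y$ which is linearly expanding at rate $1$, then $X$ has property $\mathcal Q_p$. (2) Suppose $p=\infty$. If there is a coarse map $f\colon X\to Y$ which is expanding at rate $1$, then $X$ has property $\mathcal Q_\infty$ (that is, property $\mathcal Q$).
   Context: For $k\in\mathbb N$ and an infinite $\mathbb M\subseteq\mathbb N$, $[\mathbb M]^k$ denotes the set of all $k$-element subsets of $\mathbb M$, written $\bar n=(n_1,\dots,n_k)$ with $n_1<\dots<n_k$. The interlacing metric $d_{\mathbb I}$ on $[\mathbb N]^k$ is the shortest path metric of the graph on $[\mathbb N]^k$ in which distinct $\bar n,\bar m$ are adjacent if and only if either $n_1\le m_1\le n_2\le m_2\le\dots\le n_k\le m_k$ or $m_1\le n_1\le m_2\le n_2\le\dots\le m_k\le n_k$. For $p\in(1,\infty]$, a Banach space $X$ has property $\mathcal Q_p$ if there is $C\ge1$ such that for all $k\in\mathbb N$ and all $1$-Lipschitz maps $\phi\colon([\mathbb N]^k,d_{\mathbb I})\to X$ there is an infinite $\mathbb M\subseteq\mathbb N$ such that $\mathrm{diam}(\phi([\mathbb M]^k))\le Ck^{1/p}$ (with $1/\infty=0$). Property $\mathcal Q_\infty$ is called property $\mathcal Q$. A map $f\colon X\to Y$ between Banach spaces is coarse if $\omega_f(t)=\sup\{\|f(x)-f(z)\| : \|x-z\|\le t\}<\infty$ for all $t\ge 0$. A map $f\colon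 X\to Y$ between Banach spaces is expanding at rate $1$ if for every $L>0$ there is a map $\rho\colon[0,\infty)\to[0,\infty)$ with $\lim_{t\to\infty}\rho(t)=\infty$ such that, for all $x,z\in X$, $\|x-z\|\ge L\max\{\|x\|,\|z\|\}+L$ implies $\|f(x)-f(z)\|\ge\rho(\|x-z\|)$. It is linearly expanding at rate $1$ if for every $L>0$ there is $C>0$ such that, for all $x,z\in X$, $\|x-z\|\ge L\max\{\|x\|,\|z\|\}+L$ implies $\|f(x)-f(z)\|\ge\frac1C\|x-z\|-C$. *)

(* Defs.v *)
From HB Require Import structures.
From mathcomp Require Import all_boot all_order all_algebra.
From mathcomp Require Import all_classical all_reals all_analysis.

Set Implicit Arguments.
Unset Strict Implicit.
Unset Printing Implicit Defensive.

Import Order.TTheory GRing.Theory Num.Theory.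
Import numFieldNormedType.Exports.

(* A k-element subset of nat is represented by its increasing enumeration. *)
Definition ksubset (k : nat) := {n : k.-tuple nat | sorted ltn n}.

Section InterlacingGraph.
Local Open Scope nat_scope.
Variable k : nat.
Implicit Types n m : ksubset k.

(* n_1 <= m_1 <= n_2 <= m_2 <= ... <= n_k <= m_k *)
Definition interlaced n m : bool :=
  [forall i : 'I_k, tnth (val n) i <= tnth (val m) i] &&
  [forall i : 'I_k, forall j : 'I_k,
     (j == i.+1 :> nat) ==> (tnth (val m) i <= tnth (val n) j)].

Definition interlacing_adj n m : bool :=
  (n != m) && (interlaced n m || interlaced m n).

Definition interlacing_path n m (d : nat) : Prop :=
  exists s : seq (ksubset k),
    [/\ path interlacing_adj n s, last n s = m & size s = d].

Let conn n m := exists d, interlacing_path n m d.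

Let conn_refl n : conn n n.
Proof. by exists 0, [::]. Qed.

Let conn_trans n m l : conn n m -> conn m l -> conn n l.
Proof.
move=> [_ [s [ps ls _]]] [_ [t [pt lt _]]].
exists (size (s ++ t)), (s ++ t); split => //.
- by rewrite cat_path ps ls.
- by rewrite last_cat ls.
Qed.

Let conn_sym n m : conn n m -> conn m n.
Proof.
move=> [_ [s [ps ls _]]].
exists (size (rev (belast n s))), (rev (belast n s)); split => //.
- rewrite -ls rev_path (eq_path (e' := interlacing_adj)) // => x y.
  by rewrite /interlacing_adj eq_sym orbC.
- by case: s ps ls => [_ /=|x s _ _]; [move=> -> | rewrite /= rev_cons last_rcons].
Qed.

Let conn_interlaced n m : interlaced n m -> conn n m.
Proof.
move=> nm; have [->|ne] := eqVneq n m; first exact: conn_refl.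
by exists 1, [:: m]; split => //=; rewrite /interlacing_adj ne nm.
Qed.

Let ksubset_of (g : nat -> nat) :
  (forall i, i.+1 < k -> g i < g i.+1) ->
  {n : ksubset k | forall i : 'I_k, tnth (val n) i = g i}.
Proof.
move=> gP; have sg : sorted ltn [tuple g i | i < k].
  apply/(sortedP 0) => i; rewrite size_tuple => ik.
  have ik' : i < k by exact: ltnW.
  rewrite -(tnth_nth 0 _ (Ordinal ik)) -(tnth_nth 0 _ (Ordinal ik')) !tnth_mktuple.
  exact: gP.
by exists (exist (fun t : k.-tuple nat => is_true (sorted ltn t)) _ sg) => i; rewrite /= tnth_mktuple.
Qed.

Let ksubset_lt n i : i.+1 < k -> nth 0 (val n) i < nth 0 (val n) i.+1.
Proof.
by move=> ik; have /(sortedP 0) := valP n; apply; rewrite size_tuple.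
Qed.

Let conn_le n m :
  (forall i, i < k -> nth 0 (val n) i <= nth 0 (val m) i) -> conn n m.
Proof.
move=> nm.
pose g j i := nth 0 (if i < j then val n : seq nat else val m) i.
have gP j i : i.+1 < k -> g j i < g j i.+1.
  move=> ik; rewrite /g; case: ifP => ij; case: ifP => ij1; try exact: ksubset_lt.
  - exact: leq_trans (ksubset_lt _ ik) (nm _ ik).
  - by rewrite (ltnW ij1) in ij.
pose h j := sval (ksubset_of (@gP j)).
have hE j i : tnth (val (h j)) i = g j i by rewrite /h; case: ksubset_of.
have h0 : h 0 = m.
  by apply/val_inj/eq_from_tnth => i; rewrite hE /g /= (tnth_nth 0).
have hk : h k = n.
  by apply/val_inj/eq_from_tnth => i; rewrite hE /g /= ltn_ord (tnth_nth 0).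
suff H j : conn (h j) (h 0) by rewrite -h0 -hk.
elim: j => [|j IH]; first exact: conn_refl.
apply: conn_trans IH; apply: conn_interlaced; apply/andP; split.
  apply/forallP => i; rewrite !hE /g ltnS.
  case: (ltngtP i j) => //= _; exact: nm.
apply/forallP => i; apply/forallP => l; apply/implyP => /eqP li.
have ik : i.+1 < k by rewrite -li.
have -> : tnth (val (h j.+1)) l = g j.+1 i.+1 by rewrite hE li.
rewrite hE /g ltnS; case: ifP => _; exact/ltnW/ksubset_lt.
Qed.

Lemma interlacing_connected n m : exists d, `[< interlacing_path n m d >].
Proof.
suff [d nm] : conn n m by exists d; apply/asboolP.
pose g i := maxn (nth 0 (val n) i) (nth 0 (val m) i).
have gP i : i.+1 < k -> g i < g i.+1.
  move=> ik; rewrite /g gtn_max !leq_max.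
  by rewrite !(ksubset_lt _ ik) orbT.
have [l lE] := ksubset_of gP.
have lg i : i < k -> nth 0 (val l) i = g i.
  by move=> ik; rewrite -(lE (Ordinal ik)) (tnth_nth 0).
apply: (@conn_trans _ l); last apply: conn_sym.
- by apply: conn_le => i ik; rewrite lg// leq_maxl.
- by apply: conn_le => i ik; rewrite lg// leq_maxr.
Qed.

Definition interlacing_dist n m : nat := ex_minn (interlacing_connected n m).

End InterlacingGraph.

Local Open Scope classical_set_scope.
Local Open Scope ring_scope.

(* The set [M]^k of all k-element subsets of M. *)
Definition ksubsets (M : set nat) (k : nat) : set (ksubset k) :=
  [set n | forall i : 'I_k, M (tnth (val n) i)].
Arguments ksubsets : clear implicits.

Definition diam (R : realType) (X : normedModType R) (A : set X) : \bar R :=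
  ereal_sup [set (`|x - y|)%:E | x in A & y in A].

Definition interlacing_lipschitz1 (R : realType) (X : normedModType R)
    (k : nat) (phi : ksubset k -> X) : Prop :=
  forall n m, `|phi n - phi m| <= (interlacing_dist n m)%:R.

(* The exponent is fine p^-1 with the inverse taken in \bar R, so that it is 0
   when p = +oo; the definition is meant for 1 < p. *)
Definition property_Q (R : realType) (p : \bar R) (X : normedModType R) : Prop :=
  exists C : R, 1 <= C /\
    forall k : nat, (0 < k)%N ->
    forall phi : ksubset k -> X, interlacing_lipschitz1 phi ->
    exists M : set nat, infinite_set M /\
      (diam (phi @` ksubsets M k) <= (C * k%:R `^ fine (p^-1)%E)%:E)%E.

Section CoarseMaps.
Variables (R : realType) (X Y : normedModType R).
Implicit Type f : X -> Y.

Definition expansion_modulus f (t : R) : \bar R :=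
  ereal_sup [set (`|f u.1 - f u.2|)%:E | u in [set u : X * X | `|u.1 - u.2| <= t]].

Definition coarse f : Prop :=
  forall t : R, 0 <= t -> (expansion_modulus f t < +oo)%E.

(* rho is a function on [0, +oo[; its values at negative reals are irrelevant. *)
Definition expanding_rate1 f : Prop :=
  forall L : R, 0 < L ->
  exists rho : R -> R,
    [/\ forall t, 0 <= t -> 0 <= rho t,
        rho t @[t --> +oo] --> +oo &
        forall x z : X, L * Num.max `|x| `|z| + L <= `|x - z| ->
          rho `|x - z| <= `|f x - f z|].

Definition linearly_expanding_rate1 f : Prop :=
  forall L : R, 0 < L ->
  exists C : R, 0 < C /\
    forall x z : X, L * Num.max `|x| `|z| + L <= `|x - z| ->
      C^-1 * `|x - z| - C <= `|f x - f z|.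

End CoarseMaps.

(* Main.v *)
Require Import Defs.
From mathcomp Require Import all_boot all_order all_algebra.
From mathcomp Require Import all_classical all_reals all_analysis.
From mathcomp Require Import lra.

(** Let [d] be the infimum, over infinite sets [M], of the diameter of
[phi([M]^k)]; it is finite because [[N]^k] has interlacing diameter at most
[2k].  Fix [M0] with diameter at most [2d] and translate [phi] so that it
vanishes at some point of [[M0]^k].  Applying property Q_p of [Y] to
[f \o phi] on [M0] yields [M] inside [M0] on which [f \o phi] has small
diameter, while [phi] has norm at most [2d] and diameter at least [d] on
[[M]^k].  Hence there are points [x, z] of [phi([M]^k)] with
[|x - z| >= d / 2] and [|x|, |z| <= 2d], and expansion at rate 1 with
[L = 1/8] bounds [d]. *)

Set Implicit Arguments.
Unset Strict Implicit.
Unset Printing Implicit Defensive.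

Import Order.TTheory GRing.Theory Num.Theory.
Import numFieldNormedType.Exports.

Local Open Scope classical_set_scope.
Local Open Scope ring_scope.

(** * Finite subsets under strictly increasing maps *)

Section Ksubsets.
Local Open Scope nat_scope.

(** Infinite sets are handled through increasing enumerations: this map carries [[N]^k] onto
    [[range e]^k] and preserves interlacing. *)
Definition ksubset_map k (e : nat -> nat) (he : {homo e : i j / i < j})
    (n : ksubset k) : ksubset k :=
  exist (fun t : k.-tuple nat => is_true (sorted ltn t))
    (map_tuple e (val n)) (homo_sorted he _ (valP n)).

Definition ksubset_iota k (j : nat) : ksubset k :=
  exist (fun t : k.-tuple nat => is_true (sorted ltn t))
    (iota_tuple k j) (iota_ltn_sorted j k).

Lemma tnth_ksubset_map k e (he : {homo e : i j / i < j}) (n : ksubset k) i :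
  tnth (val (ksubset_map he n)) i = e (tnth (val n) i).
Proof. by rewrite tnth_map. Qed.

Lemma tnth_ksubset_iota k j (i : 'I_k) :
  tnth (val (ksubset_iota k j)) i = j + i.
Proof. by rewrite (tnth_nth 0) /= nth_iota. Qed.

Lemma ksubset_eq k (n m : ksubset k) :
  (forall i, tnth (val n) i = tnth (val m) i) -> n = m.
Proof. by move=> nm; apply/val_inj/eq_from_tnth. Qed.

Lemma ltn_tnth_ksubset k (n : ksubset k) (i j : 'I_k) :
  i < j -> tnth (val n) i < tnth (val n) j.
Proof.
move=> ij; rewrite !(tnth_nth 0).
by apply: (sorted_ltn_nth ltn_trans _ (valP n)); rewrite ?inE ?size_tuple.
Qed.

Lemma interlaced_ksubset_map k e (he : {homo e : i j / i < j}) (n m : ksubset k) :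
  interlaced n m -> interlaced (ksubset_map he n) (ksubset_map he m).
Proof.
move=> /andP[/forallP h1 /forallP h2]; apply/andP; split.
  by apply/forallP => i; rewrite !tnth_ksubset_map (leq_mono he).
apply/forallP => i; apply/forallP => j; apply/implyP => ij.
have /forallP/(_ j)/implyP/(_ ij) h := h2 i.
by rewrite !tnth_ksubset_map (leq_mono he).
Qed.

Lemma interlaced_iota k j : interlaced (ksubset_iota k j) (ksubset_iota k j.+1).
Proof.
apply/andP; split.
  by apply/forallP => i; rewrite !tnth_ksubset_iota leq_add2r.
apply/forallP => i; apply/forallP => l; apply/implyP => /eqP il.
by rewrite !tnth_ksubset_iota il addSnnS.
Qed.

(** The map [e] lists [n] first and continues with [N + i] for [i >= k]. Sliding a block of [k]
    consecutive integers along [e] thus leads in [k] interlaced steps from [n] to a block that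
    depends only on [N] and [k]. *)
Lemma ksubset_extend k (n : ksubset k) (N : nat) :
  (forall i, tnth (val n) i < N) ->
  exists (e : nat -> nat) (he : {homo e : i j / i < j}),
    n = ksubset_map he (ksubset_iota k 0) /\
    ksubset_map he (ksubset_iota k k) = ksubset_iota k (N + k).
Proof.
move=> nN; pose e i := if insub i is Some u then tnth (val n) u else N + i.
have eE (u : 'I_k) : e u = tnth (val n) u by rewrite /e valK.
have eN i : k <= i -> e i = N + i by move=> ki; rewrite /e insubF // ltnNge ki.
have he : {homo e : i j / i < j}.
  move=> i j ij; have [jk|kj] := ltnP j k.
    have ik := ltn_trans ij jk.
    by rewrite (eE (Ordinal ik)) (eE (Ordinal jk)) ltn_tnth_ksubset.
  rewrite (eN j kj); have [ik|ki] := ltnP i k.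
    by rewrite (eE (Ordinal ik)) ltn_addr.
  by rewrite eN // ltn_add2l.
exists e, he; split; apply: ksubset_eq => i.
  by rewrite tnth_ksubset_map tnth_ksubset_iota add0n eE.
by rewrite tnth_ksubset_map !tnth_ksubset_iota eN ?leq_addr // addnA.
Qed.

Lemma infinite_set_subsequence (M : set nat) : infinite_set M ->
  exists2 e : nat -> nat, {homo e : i j / i < j} & forall i, M (e i).
Proof.
move=> Minf.
have next (i : nat) : exists j : nat, M j /\ i < j.
  apply: contrapT => H; apply: Minf.
  apply: (@sub_finite_set _ _ `I_i.+1) => [j Mj /=|]; last exact: finite_II.
  by rewrite ltnS leqNgt; apply/negP => ij; apply: H; exists j.
have [g gP] := choice next.
(* The iteration starts at [g 0], as [0] need not lie in [M]. *)
exists (fun i => iter i g (g 0)).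
  by apply: homo_ltn => [|i]; [exact: ltn_trans | exact: (gP _).2].
by case=> [|i]; exact: (gP _).1.
Qed.

Lemma infinite_range_homo (e : nat -> nat) :
  {homo e : i j / i < j} -> infinite_set (range e).
Proof.
move=> /leq_mono/incn_inj einj.
by rewrite (eq_finite_set (inj_card_eq (in2W einj))); exact: infinite_nat.
Qed.

Lemma ksubsets_range k (e : nat -> nat) (he : {homo e : i j / i < j})
    (n : ksubset k) :
  ksubsets (range e) k n -> exists n', n = ksubset_map he n'.
Proof.
move=> nM; have me := leqW_mono (leq_mono he).
have /choice[a aP] : forall i : 'I_k, exists x, e x = tnth (val n) i.
  by move=> i; have [x _ <-] := nM i; exists x.
have sa : sorted ltn [tuple a i | i < k].
  rewrite -(mono_sorted me); have := valP n.
  congr (is_true (sorted _ _)).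
  by rewrite -map_comp (eq_map aP) /= map_tnth_enum.
exists (exist (fun t : k.-tuple nat => is_true (sorted ltn t)) _ sa).
by apply: ksubset_eq => i; rewrite tnth_ksubset_map tnth_mktuple.
Qed.

End Ksubsets.

(** * Lipschitz maps for the interlacing metric *)

Section Lipschitz.
Variables (R : realType) (X : normedModType R) (k : nat) (phi : ksubset k -> X).

Lemma lipschitz1_interlaced : interlacing_lipschitz1 phi ->
  forall n m, interlaced n m -> `|phi n - phi m| <= 1.
Proof.
move=> Lphi n m nm; have [->|ne] := eqVneq n m; first by rewrite subrr normr0.
apply: le_trans (Lphi n m) _; rewrite -[1]/(1%:R) ler_nat /interlacing_dist.
case: ex_minnP => d _; apply; apply/asboolP.
by exists [:: m]; split => //=; rewrite /interlacing_adj ne nm.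
Qed.

(** Sum the increments along a shortest path. *)
Lemma interlaced_lipschitz1 :
  (forall n m, interlaced n m -> `|phi n - phi m| <= 1) ->
  interlacing_lipschitz1 phi.
Proof.
move=> H n m; rewrite /interlacing_dist.
case: ex_minnP => _ /asboolP[s [ps <- <-]] _.
elim: s n ps => [|l s IH] n /=; first by rewrite subrr normr0.
case/andP => /andP[_ nl] /IH ls; rewrite -nat1r.
apply: le_trans (ler_distD (phi l) _ _) _; apply: lerD => //.
by case/orP: nl => /H //; rewrite distrC.
Qed.

(** Both sets reach a common block far to the right in [k] interlaced steps each. *)
Lemma lipschitz1_bounded : interlacing_lipschitz1 phi ->
  forall n m, `|phi n - phi m| <= (2 * k)%:R.
Proof.
move=> /lipschitz1_interlaced H n m.
(* A number strictly above all entries of [n] and [m]. *)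
pose N := (\sum_i tnth (val n) i + \sum_i tnth (val m) i).+1.
have key l : (forall i, (tnth (val l) i < N)%N) ->
    `|phi l - phi (ksubset_iota k (N + k))| <= k%:R.
  move=> lN; have [e [he [-> <-]]] := ksubset_extend lN.
  suff : forall j, `|phi (ksubset_map he (ksubset_iota k 0))
      - phi (ksubset_map he (ksubset_iota k j))| <= j%:R by [].
  elim=> [|i IH]; first by rewrite subrr normr0.
  rewrite -natr1.
  apply: le_trans (ler_distD (phi (ksubset_map he (ksubset_iota k i))) _ _) _.
  by apply: lerD => //; exact/H/interlaced_ksubset_map/interlaced_iota.
apply: le_trans (ler_distD (phi (ksubset_iota k (N + k))) _ _) _.
rewrite mul2n -addnn natrD; apply: lerD; last rewrite distrC; apply: key => i.
- by rewrite ltnS (bigD1 i) //= -!addnA leq_addr.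
- by rewrite ltnS [X in (_ + X)%N](bigD1 i) //= addnCA leq_addr.
Qed.

End Lipschitz.

Lemma diam_le (R : realType) (X : normedModType R) (A : set X) (b : R) :
  (diam A <= b%:E)%E <-> forall x y, A x -> A y -> `|x - y| <= b.
Proof.
split=> [Ab x y Ax Ay|H].
  rewrite -lee_fin; apply: le_trans Ab; apply: ereal_sup_ubound.
  by exists x => //; exists y.
by apply: ge_ereal_sup => _ [x Ax [y Ay <-]]; rewrite lee_fin H.
Qed.

Lemma coarse_bounded (R : realType) (X Y : normedModType R) (f : X -> Y) :
  coarse f ->
  exists2 c : R, 0 < c & forall x z, `|x - z| <= 1 -> `|f x - f z| <= c.
Proof.
move=> /(_ 1 ler01) fc.
have [c fE] : exists c : R, (expansion_modulus f 1 <= c%:E)%E.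
  case: (expansion_modulus f 1) fc => [c _| |_]; [by exists c | | by exists 0; rewrite leNye].
  by rewrite ltxx.
(* The maximum makes the constant positive, so that [f] can later be divided by it. *)
exists (Num.max 1 c) => [|x z xz]; first by rewrite lt_max ltr01.
rewrite le_max; apply/orP; right; rewrite -lee_fin.
by apply: le_trans fE; apply: ereal_sup_ubound; exists (x, z).
Qed.

(** The argument common to finite and infinite [p]: [D] is the diameter bound available in [Y], [B]
    the one wanted in [X]. *)
Lemma expanding_diam_le (R : realType) (X Y : normedModType R) (f : X -> Y)
    (k : nat) (c D B : R) (phi : ksubset k -> X) :
  (forall x z, `|x - z| <= 1 -> `|f x - f z| <= c) -> 0 < c -> 1 <= B ->
  (forall psi : ksubset k -> Y, interlacing_lipschitz1 psi ->
    exists M, infinite_set M /\ (diam (psi @` ksubsets M k) <= D%:E)%E) ->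
  (forall x z, B / 2 <= `|x - z| ->
     8^-1 * Num.max `|x| `|z| + 8^-1 <= `|x - z| -> c * D < `|f x - f z|) ->
  interlacing_lipschitz1 phi ->
  exists M, infinite_set M /\ (diam (phi @` ksubsets M k) <= B%:E)%E.
Proof.
move=> fc c0 B1 QY fexp Lphi.
(* [P e b] bounds the diameter of [phi] on [[range e]^k] by [b], so [inf S] is the infimal diameter
   [d]. *)
pose P (e : nat -> nat) (b : R) := exists he : {homo e : i j / (i < j)%N},
  forall n m, `|phi (ksubset_map he n) - phi (ksubset_map he m)| <= b.
pose S := [set b | exists e, P e b].
have hid : {homo (fun i : nat => i) : i j / (i < j)%N} by [].
have S0 : S !=set0.
  by exists (2 * k)%:R, id, hid => n m; exact: lipschitz1_bounded.
have Slb : lbound S 0.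
  move=> b [e [he /(_ (ksubset_iota k 0) (ksubset_iota k 0))]].
  by rewrite subrr normr0.
have hS : has_inf S by split=> //; exists 0.
have [SB|BS] := ltP (inf S) B.
  have [b [e [he eb]] bB] := inf_lt S0 SB.
  exists (range e); split; first exact: infinite_range_homo.
  apply/diam_le => _ _ [n /(ksubsets_range he)[n' ->] <-]
    [m /(ksubsets_range he)[m' ->] <-].
  exact: le_trans (eb _ _) (ltW bB).
exfalso; set d := inf S in BS.
(* Positivity of [d] comes from [1 <= B <= d]. *)
have dd : d < 2 * d by lra.
have [b [e [he eb]] bd] := inf_lt S0 dd.
pose v := phi (ksubset_map he (ksubset_iota k 0)).
pose psi n := phi (ksubset_map he n) - v.
have [M [Minf MD]] : exists M, infinite_set M /\
    (diam ((fun n => c^-1 *: f (psi n)) @` ksubsets M k) <= D%:E)%E.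
  (* Interlaced sets have [psi]-values at distance at most 1, which [f] sends to points at distance
     at most [c]; the factor [c^-1] restores the constant 1. *)
  apply/QY/interlaced_lipschitz1 => n m nm.
  rewrite -scalerBr normrZ gtr0_norm ?invr_gt0 // ler_pdivrMl // mulr1.
  apply: fc; rewrite /psi opprB addrA subrK.
  exact/(lipschitz1_interlaced Lphi)/interlaced_ksubset_map.
have [e' he' Me'] := infinite_set_subsequence Minf.
have hee : {homo e \o e' : i j / (i < j)%N} by move=> i j ij; exact/he/he'.
have mapE n : ksubset_map hee n = ksubset_map he (ksubset_map he' n).
  by apply: ksubset_eq => i; rewrite !tnth_ksubset_map.
have [n [m nm]] : exists n m : ksubset k,
    d / 2 < `|psi (ksubset_map he' n) - psi (ksubset_map he' m)|.
  apply: contrapT => H.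
  (* Otherwise [e \o e'] would witness a diameter below the infimum. *)
  have : S (d / 2).
    exists (e \o e'), hee => n m; rewrite leNgt; apply/negP => nm; apply: H.
    by exists n, m; rewrite /psi opprB addrA subrK -!mapE.
  by move=> /(ge_inf hS.2); rewrite -/d; lra.
have inM l : ksubsets M k (ksubset_map he' l).
  by move=> i; rewrite tnth_ksubset_map.
have psib l : `|psi l| <= b by exact: eb.
set x := psi _ in nm; set z := psi (ksubset_map he' m) in nm.
have : c * D < `|f x - f z|.
  apply: fexp; first by lra.
  (* Since [b < 2 * d] and [1 <= d], the left side is at most [d / 4 + d / 8], which is below
     [d / 2]. *)
  have : Num.max `|x| `|z| <= b by rewrite ge_max !psib.
  by lra.
apply/negP; rewrite -leNgt.
have /diam_le/(_ (c^-1 *: f x) (c^-1 *: f z)) := MD.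
rewrite -scalerBr normrZ gtr0_norm ?invr_gt0 // ler_pdivrMl //.
by apply; [exists (ksubset_map he' n) | exists (ksubset_map he' m)].
Qed.

Theorem theorem1p8 (R : realType) (X Y : completeNormedModType R) (p : \bar R)
    (p_gt1 : (1 < p)%E) (QpY : property_Q p Y) :
  ((p < +oo)%E ->
     (exists f : X -> Y, coarse f /\ linearly_expanding_rate1 f) ->
     property_Q p X) /\
  (p = +oo%E ->
     (exists f : X -> Y, coarse f /\ expanding_rate1 f) ->
     property_Q (+oo%E : \bar R) X).
Proof.
have [C [C1 QY]] := QpY.
have C0 : 0 < C by lra.
have L0 : (0 : R) < 8^-1 by lra.
split=> [poo [f [/coarse_bounded[c c0 fc] /(_ _ L0)[A [A0 fA]]]]|
         pE [f [/coarse_bounded[c c0 fc] /(_ _ L0)[rho [_ rhooo frho]]]]].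
  have cC := mulr_gt0 c0 C0.
  (* Chosen so that [A' * q / 2 > A * (c * (C * q) + A)] whenever [q >= 1]. *)
  pose A' := 2 * A * (A + c * C + 1) + 1.
  have A'1 : 1 <= A' by rewrite /A' lerDr !mulr_ge0 //; lra.
  exists A'; split=> // k k0 phi.
  set q := k%:R `^ _.
  have q1 : 1 <= q.
    have r0 : 0 <= fine p^-1%E.
      case: p p_gt1 poo {QpY QY q} => [r||] //; rewrite lte_fin => r1 _.
      by rewrite inver ifF ?invr_ge0 ?gt_eqF //; lra.
    by rewrite -(powRr0 k%:R) ler_powR // ler1n.
  apply: (expanding_diam_le fc c0 _ (QY k k0)).
    by rewrite -[1]mulr1 ler_pM.
  move=> x z xz /fA; apply: lt_le_trans.
  rewrite ltrBrDr ltr_pdivlMl //; apply: lt_le_trans xz.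
  rewrite -/q /A'; nra.
have [T TP] : exists T, forall t, T <= t -> c * C < rho t.
  have /cvgryPgt/(_ (c * C))[T [_ TP]] := rhooo.
  (* The limit gives the bound only strictly beyond [T]. *)
  by exists (T + 1) => t Tt; apply: TP; rewrite /=; lra.
have B1 : 1 <= Num.max 1 (2 * T) by rewrite le_max lexx.
exists (Num.max 1 (2 * T)); split=> // k k0 phi.
(* The exponent is 0, so the bound in [Y] is [C] for every [k], and a single threshold [T] serves
   all [k]. *)
have QYk := QY k k0; rewrite pE !invey /= !powRr0 !mulr1 in QYk *.
apply: (expanding_diam_le fc c0 B1 QYk) => x z xz /frho; apply: lt_le_trans.
apply: TP; apply: le_trans xz.
have : 2 * T <= Num.max 1 (2 * T) by rewrite le_max lexx orbT.
by lra.
Qed.
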